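(* Let $m,n$ be positive integers and let $\mathcal{C}$ be a symmetric Cauchy tensor of order $m$ and dimension $n$. Then $\mathcal{C}$ is centrosymmetric if and only if $J\mathcal{C}=\mathcal{C}$.
   Context: Write $[n]=\{1,\dots,n\}$. Given $c=(c_1,\dots,c_n)\in\mathbb{R}^n$ with $c_{i_1}+\cdots+c_{i_m}\ne0$ for all $i_1,\dots,i_m\in[n]$, the (symmetric) Cauchy tensor of order $m$ and dimension $n$ with generating vector $c$ is the real tensor $\mathcal{C}=(c_{i_1\cdots i_m})$ with entries $c_{i_1i_2\cdots i_m}=\dfrac{1}{c_{i_1}+c_{i_2}+\cdots+c_{i_m}}$. A tensor $(a_{i_1\cdots i_m})$ of order $m$ and dimension $n$ is centrosymmetric if $a_{i_1\cdots i_m}=a_{n-i_1+1,\dots,n-i_m+1}$ for all indices in $[n]$. $J$ is the $n\times n$ matrix with $J_{ij}=\delta_{i,\,n-j+1}$, and $J\mathcal{C}$ is the tensor of order $m$ and dimension $n$ with entries $(J\mathcal{C})_{i_1\cdots i_m}=\sum_{t\in[n]}J_{i_1t}c_{ti_2\cdots i_m}$. *)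

(* Defs.v *)
From HB Require Import structures.
From mathcomp Require Import all_boot all_order all_algebra.
From mathcomp Require Import reals.

Set Implicit Arguments.
Unset Strict Implicit.
Unset Printing Implicit Defensive.

Import Order.TTheory GRing.Theory Num.Theory.

Local Open Scope ring_scope.

(* Indices in [n] = {1, ..., n} are shifted to 'I_n = {0, ..., n-1}, so the
   reflection i |-> n - i + 1 becomes [rev_ord], i |-> n - i.+1. *)
Definition tensor (R : realType) (m n : nat) : Type :=
  {ffun m.-tuple 'I_n -> R}.

Definition cauchy_sum (R : realType) (m n : nat) (c : 'rV[R]_n)
    (i : m.-tuple 'I_n) : R :=
  \sum_(k < m) c 0 (tnth i k).

Definition cauchy_tensor (R : realType) (m n : nat) (c : 'rV[R]_n) :
    tensor R m n :=
  [ffun i : m.-tuple 'I_n => (cauchy_sum c i)^-1].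

Definition is_cauchy_tensor (R : realType) (m n : nat) (C : tensor R m n) :
    Prop :=
  exists c : 'rV[R]_n,
    (forall i : m.-tuple 'I_n, cauchy_sum c i != 0) /\ C = cauchy_tensor m c.

Definition centrosymmetric (R : realType) (m n : nat) (T : tensor R m n) :
    Prop :=
  forall i : m.-tuple 'I_n, T i = T (map_tuple (@rev_ord n) i).

Definition exchange_mx (R : realType) (n : nat) : 'M[R]_n :=
  \matrix_(i < n, j < n) (i == rev_ord j)%:R.

(* (A T)_(i_1, i_2, ...) = \sum_t A_(i_1, t) T_(t, i_2, ...); the order is
   m.+1 because a first index is needed. *)
Definition mul_mx_tensor (R : realType) (m n : nat) (A : 'M[R]_n)
    (T : tensor R m.+1 n) : tensor R m.+1 n :=
  [ffun i : m.+1.-tuple 'I_n =>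
    \sum_(t < n) A (thead i) t * T (cons_tuple t (behead_tuple i))].

(* Main.v *)
(** Both conditions say that the generating vector is a palindrome,
    [c_(n-i+1) = c_i]. On the diagonal index [(i, ..., i)], centrosymmetry reads
    [m c_i = m c_(n-i+1)] and [J C = C] reads
    [c_(n-i+1) + (m-1) c_i = m c_i]; conversely a palindromic [c] has the same
    index sums before and after reflecting any of the indices. *)
Require Import Defs.
From HB Require Import structures.
From mathcomp Require Import all_boot all_order all_algebra.
From mathcomp Require Import reals.

Set Implicit Arguments.
Unset Strict Implicit.
Unset Printing Implicit Defensive.

Import Order.TTheory GRing.Theory Num.Theory.

Local Open Scope ring_scope.

(** Row [thead i] of the exchange matrix has its single nonzero entry, a 1, in column
    [rev_ord (thead i)], so only that term of the sum over [t] survives. *)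
Lemma mul_exchange_mx_tensorE (R : realType) (m n : nat) (T : tensor R m.+1 n)
    (i : m.+1.-tuple 'I_n) :
  mul_mx_tensor (exchange_mx R n) T i =
  T (cons_tuple (rev_ord (thead i)) (behead_tuple i)).
Proof.
rewrite ffunE (bigD1 (rev_ord (thead i))) //= mxE rev_ordK eqxx mul1r.
rewrite big1 ?addr0 // => t neq_t; rewrite mxE -(inj_eq rev_ord_inj) rev_ordK.
by rewrite eq_sym (negPf neq_t) mul0r.
Qed.

Lemma cauchy_sum_cons (R : realType) (m n : nat) (c : 'rV[R]_n) (a : 'I_n)
    (i : m.-tuple 'I_n) :
  cauchy_sum c (cons_tuple a i) = c 0 a + cauchy_sum c i.
Proof.
rewrite /cauchy_sum big_ord_recl; congr (_ + _).
by apply: eq_bigr => k _; rewrite !(tnth_nth a).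
Qed.

Lemma cauchy_sum_nseq (R : realType) (m n : nat) (c : 'rV[R]_n) (a : 'I_n) :
  cauchy_sum c (nseq_tuple m a) = c 0 a *+ m.
Proof.
rewrite /cauchy_sum (eq_bigr (fun=> c 0 a)) ?sumr_const ?card_ord // => k _.
by rewrite (tnth_nth a) nth_nseq ltn_ord.
Qed.

Lemma centrosymmetric_cauchyP (R : realType) (m n : nat) (c : 'rV[R]_n) :
  centrosymmetric (cauchy_tensor m.+1 c) <->
  forall a, c 0 (rev_ord a) = c 0 a.
Proof.
split=> [cs a | pal i].
  have := cs (nseq_tuple m.+1 a); rewrite !ffunE.
  have -> : map_tuple (@rev_ord n) (nseq_tuple m.+1 a) =
            nseq_tuple m.+1 (rev_ord a) by apply: val_inj; rewrite /= map_nseq.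
  (* Inversion is injective on the whole field, with [0^-1 = 0], and the positive multiple [m.+1]
     cancels in an ordered field. *)
  by rewrite !cauchy_sum_nseq => /invr_inj /(pmulrnI (ltn0Sn m)) ->.
rewrite !ffunE; congr (_^-1); apply: eq_bigr => k _.
by rewrite tnth_map pal.
Qed.

Lemma mul_exchange_mx_cauchyP (R : realType) (m n : nat) (c : 'rV[R]_n) :
  mul_mx_tensor (exchange_mx R n) (cauchy_tensor m.+1 c) =
    cauchy_tensor m.+1 c <->
  forall a, c 0 (rev_ord a) = c 0 a.
Proof.
split=> [fixC a | pal].
  (* The diagonal index is split into a head and a constant tail: the exchange matrix reflects only
     the head, so the sum over the tail is common to both sides and cancels. *)
  have /ffunP/(_ (cons_tuple a (nseq_tuple m a))) := fixC.
  rewrite mul_exchange_mx_tensorE theadE !ffunE => /invr_inj.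
  have -> : behead_tuple (cons_tuple a (nseq_tuple m a)) = nseq_tuple m a.
    exact: val_inj.
  by rewrite !cauchy_sum_cons => /addIr.
apply/ffunP => i; rewrite mul_exchange_mx_tensorE !ffunE cauchy_sum_cons pal.
by rewrite -cauchy_sum_cons [in RHS](tuple_eta i).
Qed.

Theorem theorem5p2 (R : realType) (m n : nat) (C : tensor R m.+1 n.+1)
    (hC : is_cauchy_tensor C) :
  centrosymmetric C <-> mul_mx_tensor (exchange_mx R n.+1) C = C.
Proof.
case: hC => c [_ ->].
exact: (iff_trans (centrosymmetric_cauchyP _ _)
                  (iff_sym (mul_exchange_mx_cauchyP _ _))).
Qed.
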